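(* Let $d\ge1$, $\nu>0$, and let $K\in C^\infty(\mathbb{T}^d)$ be real-valued, even, with $\int_{\mathbb{T}^d}K\,dx=0$. If $\widehat K(\xi)\ge0$ for all $\xi\in\mathbb{Z}^d\setminus\{0\}$, then $\gamma_c=+\infty$, and the linearized finite-horizon and stationary systems around the uniform equilibrium have no neutral Fourier mode for any $\gamma\ge0$. In particular, there is no Fourier-mode phase transition: no coupling $\gamma\ge 0$ at which some Fourier mode becomes neutral.
   Context: $\mathbb{T}^d=(\mathbb{R}/\mathbb{Z})^d$ and $\widehat f(\xi)=\int_{\mathbb{T}^d}f(x)e^{-2\pi i\xi\cdot x}\,dx$, $\xi\in\mathbb{Z}^d$. The critical coupling is $$\gamma_c=\min_{\xi\in\mathbb{Z}^d\setminus\{0\},\ \widehat K(\xi)<0}\frac{\nu^2(2\pi|\xi|)^2}{|\widehat K(\xi)|},$$ with $\gamma_c=+\infty$ if no $\xi\neq0$ satisfies $\widehat K(\xi)<0$. The finite-horizon mean-field game system is $$-\partial_t\phi-\nu\Delta\phi+\tfrac12|\nabla\phi|^2=\gamma K*m,\qquad \partial_tm-\nu\Delta m-\mathrm{div}(m\nabla\phi)=0,$$ and the stationary system, for $(\bar\phi,\bar m,\bar\lambda)$ with $\int\bar m=1$, $\int\bar\phi=0$, is $$-\nu\Delta\bar\phi+\tfrac12|\nabla\bar\phi|^2=\gamma K*\bar m-\bar\lambda,\qquad -\nu\Delta\bar m-\mathrm{div}(\bar m\nabla\bar\phi)=0.$$ The uniform equilibrium is $\phi=0$, $m=1$, $\lambda=0$.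 Linearizing the finite-horizon system at it, with mean-zero perturbations $w$ of $\phi$ and $\mu$ of $m$, gives $-\partial_tw-\nu\Delta w=\gamma K*\mu$, $\partial_t\mu-\nu\Delta\mu-\Delta w=0$, that is, for $\xi\ne0$ and $k_\xi=(2\pi|\xi|)^2$, $$\frac{d}{dt}\begin{pmatrix}\widehat w_\xi\\ \widehat\mu_\xi\end{pmatrix}=M_\xi\begin{pmatrix}\widehat w_\xi\\ \widehat\mu_\xi\end{pmatrix},\qquad M_\xi=\begin{pmatrix}\nu k_\xi & -\gamma\widehat K(\xi)\\ -k_\xi & -\nu k_\xi\end{pmatrix}.$$ The linearized stationary system in mode $\xi\ne0$ is $M_\xi(\widehat w_\xi,\widehat\mu_\xi)^\top=0$. A mode $\xi\ne0$ is neutral for the finite-horizon linearization if $M_\xi$ has an eigenvalue with zero real part, and neutral for the stationary linearization if $M_\xi$ has a nontrivial kernel. *)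

(* Defs.v *)
From HB Require Import structures.
From mathcomp Require Import all_boot all_order all_algebra complex.
From mathcomp Require Import all_classical all_reals all_analysis.

Set Implicit Arguments.
Unset Strict Implicit.
Unset Printing Implicit Defensive.

Import Order.TTheory GRing.Theory Num.Theory.
Import numFieldNormedType.Exports.
Local Open Scope classical_set_scope.
Local Open Scope ring_scope.
Local Open Scope complex_scope.

(** Functions on the torus (R/Z)^d are represented by Z^d-periodic functions
    on R^d = 'rV[R]_d; frequencies are vectors of 'rV[int]_d. *)

Section Torus.
Variables (R : realType) (d : nat).
Implicit Types (x : 'rV[R]_d) (xi : 'rV[int]_d).

Definition torus_periodic (T : Type) (f : 'rV[R]_d -> T) : Prop :=
  forall x xi, f (x + map_mx intr xi) = f x.

Definition even_fun (f : 'rV[R]_d -> R) : Prop := forall x, f (- x) = f x.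

Fixpoint C_k (k : nat) (f : 'rV[R]_d -> R) : Prop :=
  continuous f /\
  if k is k'.+1 then
    forall i : 'I_d,
      (forall x, derivable f x (delta_mx 0 i)) /\
      C_k k' (fun x => 'D_(delta_mx 0 i) f x)
  else True.

Definition smooth (f : 'rV[R]_d -> R) : Prop := forall k, C_k k f.

Definition dotp xi x : R := \sum_(i < d) (xi 0 i)%:~R * x 0 i.

(** The library norm [`|xi|] of a matrix is the sup norm, hence this explicit
    Euclidean norm. *)
Definition enorm xi : R := Num.sqrt (\sum_(i < d) (xi 0 i)%:~R ^+ 2).

End Torus.

(** The integral over the torus, as the Lebesgue integral over [0,1]^d,
    computed coordinate by coordinate (Fubini); it is only used for continuous
    integrands. *)
Fixpoint torus_int (R : realType) (d : nat) : ('rV[R]_d -> R) -> R :=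
  match d return ('rV[R]_d -> R) -> R with
  | 0%N => fun f => f 0
  | d'.+1 => fun f =>
      Rintegral lebesgue_measure `[0, 1]
        (fun t : R => torus_int (fun y : 'rV[R]_d' => f (row_mx t%:M y)))
  end.

Definition torus_cint (R : realType) (d : nat) (f : 'rV[R]_d -> R[i]) : R[i] :=
  torus_int (fun x => complex.Re (f x)) +i* torus_int (fun x => complex.Im (f x)).

Definition expi (R : realType) (t : R) : R[i] := cos t +i* sin t.

Definition fourier (R : realType) (d : nat) (f : 'rV[R]_d -> R[i])
    (xi : 'rV[int]_d) : R[i] :=
  torus_cint (fun x => f x * expi (- (2 * pi * dotp xi x))).

Section MeanFieldGame.
Variables (R : realType) (d : nat) (nu : R) (K : 'rV[R]_d -> R).
Implicit Types (gamma : R) (xi : 'rV[int]_d).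

Definition Khat xi : R[i] := fourier (fun x => (K x)%:C) xi.

Definition kfreq xi : R := (2 * pi * enorm R xi) ^+ 2.

(** The condition [Khat xi < 0] is for the partial order of R[i], i.e.
    [Khat xi] is real and negative (it is always real for K real and even).
    The infimum is a minimum when the set is nonempty, since [Khat] is bounded
    and [kfreq xi] tends to infinity; [ereal_inf set0 = +oo]. *)
Definition gamma_c : \bar R :=
  ereal_inf [set ((nu ^+ 2 * kfreq xi / complex.Re `|Khat xi|)%:E)
            | xi in [set xi | xi != 0 /\ Khat xi < 0]].

Definition mode_mx gamma xi : 'M[R[i]]_2 :=
  \matrix_(i < 2, j < 2)
    nth 0 (nth [::] [:: [:: (nu * kfreq xi)%:C ; - (gamma%:C * Khat xi)];
                        [:: - (kfreq xi)%:C    ; - (nu * kfreq xi)%:C  ]] i) j.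

(** [eigenvalue] is the library notion, with row eigenvectors; a square matrix
    has the same eigenvalues for row and for column vectors. *)
Definition neutral_finite_horizon gamma xi : Prop :=
  xi != 0 /\
  exists lambda : R[i], eigenvalue (mode_mx gamma xi) lambda /\ complex.Re lambda = 0.

Definition neutral_stationary gamma xi : Prop :=
  xi != 0 /\ exists v : 'cV[R[i]]_2, v != 0 /\ mode_mx gamma xi *m v = 0.

Definition fourier_phase_transition gamma : Prop :=
  exists xi, neutral_finite_horizon gamma xi \/ neutral_stationary gamma xi.

End MeanFieldGame.

(* Main.v *)
Require Import Defs.
From mathcomp Require Import all_boot all_order all_algebra complex.
From mathcomp Require Import all_classical all_reals all_analysis.
From mathcomp Require Import ring.

Set Implicit Arguments.
Unset Strict Implicit.
Unset Printing Implicit Defensive.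

Import Order.TTheory GRing.Theory Num.Theory.
Import numFieldNormedType.Exports.
Local Open Scope classical_set_scope.
Local Open Scope ring_scope.

(* The mode matrix is traceless with determinant
   [- ((nu k) ^ 2 + gamma k Khat)], so its eigenvalues are square roots of
   [(nu k) ^ 2 + gamma k Khat], which is positive as soon as [0 <= Khat].  The
   square of a number with zero real part is [<= 0], hence no such number, in
   particular not [0], is an eigenvalue. *)

(** A nonzero integer vector has a nonzero coordinate, whose square alone makes the Euclidean norm
    positive. *)
Lemma kfreq_gt0 (R : realType) (d : nat) (xi : 'rV[int]_d) :
  xi != 0 -> 0 < kfreq R xi.
Proof.
move=> xi_neq0; rewrite exprn_gt0// mulr_gt0 ?mulr_gt0 ?pi_gt0// sqrtr_gt0.
have [i xii_neq0] : exists i, xi 0 i != 0 by apply/rV0Pn.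
rewrite (bigD1 i)//= ltr_pwDl//; last by rewrite sumr_ge0// => j _; rewrite sqr_ge0.
by rewrite exprn_even_gt0//= intr_eq0.
Qed.

Lemma det_mx22 (R : comNzRingType) (A : 'M[R]_2) :
  \det A = A 0 0 * A 1 1 - A 0 1 * A 1 0.
Proof.
rewrite (expand_det_row _ 0) big_ord_recl big_ord1 /cofactor !det_mx11 !mxE /=.
rewrite expr0 expr1 mul1r mulN1r mulrN.
by congr (_ * A _ _ - A _ _ * A _ _); apply/val_inj.
Qed.

(** If [z = i b] then [z ^+ 2 = - b ^+ 2]; the order of [R[i]] also asks for equal imaginary parts,
    here both zero. *)
Lemma sqrc_Re0_le0 (R : rcfType) (z : R[i]) : complex.Re z = 0 -> z ^+ 2 <= 0.
Proof.
case: z => a b /= ->; rewrite expr2 lecE /= !mul0r mulr0 addr0 eqxx /=.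
by rewrite sub0r oppr_le0 -expr2 sqr_ge0.
Qed.

Section ModeMatrix.
Variables (R : realType) (d : nat) (nu : R) (K : 'rV[R]_d -> R).
Variables (gamma : R) (xi : 'rV[int]_d).

Lemma det_mode_mx_sub (l : R[i]) :
  \det (mode_mx nu K gamma xi - l%:M) =
  l ^+ 2 - ((nu * kfreq R xi)%:C%C ^+ 2
            + gamma%:C%C * (kfreq R xi)%:C%C * Khat K xi).
Proof. by rewrite det_mx22 !mxE/= mulr1n mulr0n; ring. Qed.

Hypotheses (nu_gt0 : 0 < nu) (gamma_ge0 : 0 <= gamma) (xi_neq0 : xi != 0).
Hypothesis Khat_ge0 : 0 <= Khat K xi.

(** Serves both notions of neutrality: any [l] on the imaginary axis for the finite horizon, [l = 0]
    for the stationary kernel. *)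
Lemma det_mode_mx_sub_neq0 (l : R[i]) :
  complex.Re l = 0 -> \det (mode_mx nu K gamma xi - l%:M) != 0.
Proof.
move=> /sqrc_Re0_le0 l2_le0; rewrite det_mode_mx_sub subr_eq0.
have k_gt0 := kfreq_gt0 R xi_neq0.
(* Strictness comes from [(nu k) ^ 2] alone, as [gamma] or [Khat] may vanish. *)
rewrite lt_eqF// (le_lt_trans l2_le0)// ltr_pwDl//.
  by rewrite exprn_gt0// ltcR mulr_gt0.
by rewrite !mulr_ge0// lecR// ltW.
Qed.

Lemma not_neutral_finite_horizon : ~ neutral_finite_horizon nu K gamma xi.
Proof.
move=> [_ [l [/eigenvalueP[v vM v_neq0] /det_mode_mx_sub_neq0/negP]]]; apply.
by apply/det0P; exists v => //; rewrite mulmxBr vM mul_mx_scalar subrr.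
Qed.

Lemma not_neutral_stationary : ~ neutral_stationary nu K gamma xi.
Proof.
move=> [_ [v [v_neq0 Mv]]].
have /negP := det_mode_mx_sub_neq0 (erefl : complex.Re (0 : R[i]) = 0).
(* [det0P] speaks of row vectors, so the column kernel vector is transposed. *)
rewrite raddf0 subr0 -det_tr; apply; apply/det0P; exists v^T.
  by rewrite trmx_eq0.
by rewrite -trmx_mul Mv trmx0.
Qed.

End ModeMatrix.

Lemma gamma_c_pinfty (R : realType) (d : nat) (nu : R) (K : 'rV[R]_d -> R) :
  (forall xi : 'rV[int]_d, xi != 0 -> 0 <= Khat K xi) -> gamma_c nu K = +oo%E.
Proof.
move=> Khat_ge0; rewrite /gamma_c (_ : [set xi | _] = set0) ?image_set0 ?ereal_inf0//.
(* In the partial order of [R[i]], [0 <= z] still excludes [z < 0], so the infimum is over the empty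
   set. *)
by apply/seteqP; split=> // xi [/Khat_ge0/le_gtF->].
Qed.

Theorem proposition1p6 (R : realType) (d : nat) (nu : R) (K : 'rV[R]_d -> R)
    (d_ge1 : (1 <= d)%N) (nu_gt0 : 0 < nu)
    (K_periodic : torus_periodic K) (K_smooth : smooth K)
    (K_even : even_fun K) (K_mean0 : torus_int K = 0)
    (Khat_ge0 : forall xi : 'rV[int]_d, xi != 0 -> 0 <= Khat K xi) :
  [/\ gamma_c nu K = +oo%E,
      forall (gamma : R) (xi : 'rV[int]_d), 0 <= gamma -> xi != 0 ->
        ~ neutral_finite_horizon nu K gamma xi /\
        ~ neutral_stationary nu K gamma xi
    & ~ exists gamma : R, 0 <= gamma /\ fourier_phase_transition nu K gamma].
Proof.
have no_neutral (gamma : R) (xi : 'rV[int]_d) : 0 <= gamma -> xi != 0 ->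
    ~ neutral_finite_horizon nu K gamma xi /\
    ~ neutral_stationary nu K gamma xi.
  move=> gamma_ge0 xi_neq0; have Khat_xi := Khat_ge0 _ xi_neq0; split.
    exact: not_neutral_finite_horizon.
  exact: not_neutral_stationary.
split=> //; first exact: gamma_c_pinfty.
(* Both kinds of neutrality have [xi != 0] as first component, so [neutral.1] fits either case. *)
by move=> [gamma [gamma_ge0 [xi [] neutral]]];
  have [nfh ns] := no_neutral _ _ gamma_ge0 neutral.1.
Qed.
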